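(* Let $A$ be a commutative unitary ring which has at most $5$ distinct ideals. Then $A$ is a principal ring, i.e. every ideal of $A$ is principal.
   Context: Ideals are counted including $\{0\}$ and $A$. *)

(* Defs.v *)
From mathcomp Require Import all_boot all_algebra.
From mathcomp Require Import all_classical.

Set Implicit Arguments.
Unset Strict Implicit.
Unset Printing Implicit Defensive.

Import GRing.Theory.
Local Open Scope ring_scope.
Local Open Scope classical_set_scope.

(* MathComp's [idealr_closed] describes decidable proper ideals of nontrivial
   rings. Here ideals are arbitrary subsets, the whole ring is an ideal, and
   the ring may be trivial. Closure under opposites follows from taking the
   scalar -1. *)
Definition is_ideal (A : comPzRingType) (I : set A) : Prop :=
  [/\ I 0,
      forall x y : A, I x -> I y -> I (x + y) &
      forall a x : A, I x -> I (a * x)].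

Definition ideals (A : comPzRingType) : set (set A) :=
  [set I | is_ideal I].
Arguments ideals A : clear implicits.

Definition principal_ideal (A : comPzRingType) (x : A) : set A :=
  [set a * x | a in [set: A]].

Definition is_principal (A : comPzRingType) (I : set A) : Prop :=
  exists x : A, I = principal_ideal x.

Definition principal_ring (A : comPzRingType) : Prop :=
  forall I : set A, is_ideal I -> is_principal I.

(* Main.v *)
Require Import Defs.
From mathcomp Require Import all_boot all_algebra.
From mathcomp Require Import all_classical.

(** A non-principal ideal [I] forces at least six ideals. It strictly contains
    each principal ideal generated by one of its elements, and an additive
    group is never the union of two proper subgroups; so for any [a] and [b] in
    [I] some element of [I] lies outside both principal ideals (a) and (b)
    ([nonprincipal_avoid2]). Applied three times from [0], this yields [x], [y]
    and [z] in [I], each outside the principal ideals generated by [0] and by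
    its predecessors. As [1] is not in [I] either, the ideals (0), (x), (y),
    (z), (1) are pairwise distinct, and [I], being non-principal, is a sixth. *)

Local Open Scope classical_set_scope.
Local Open Scope card_scope.

Import GRing.Theory.

Section Ideals.
Set Implicit Arguments.
Unset Strict Implicit.
Local Open Scope ring_scope.

Lemma uniq_size_card_le (T : choiceType) (S : set T) (n : nat) (s : seq T) :
  S #<= `I_n -> uniq s -> (forall t, t \in s -> S t) -> (size s <= n)%N.
Proof.
move=> /pcard_leP/unsquash f us sS.
rewrite -(size_map f) -[leqRHS](size_iota 0); apply: uniq_leq_size.
  rewrite map_inj_in_uniq // => t u /sS St /sS Su.
  by apply: (@inj _ _ _ f); rewrite inE.
move=> _ /mapP[t /sS St ->]; rewrite mem_iota /=.
exact: (@funS _ _ _ _ f).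
Qed.

Variable A : comPzRingType.
Implicit Types (a b x : A) (I : set A).

Lemma principal_is_ideal x : is_ideal (principal_ideal x).
Proof.
split; first by exists 0; rewrite ?mul0r.
- by move=> _ _ [a _ <-] [b _ <-]; exists (a + b); rewrite ?mulrDl.
- by move=> a _ [b _ <-]; exists (a * b); rewrite ?mulrA.
Qed.

Lemma principal_id x : principal_ideal x x.
Proof. by exists 1; rewrite ?mul1r. Qed.

Lemma principal_sub I x : is_ideal I -> I x -> principal_ideal x `<=` I.
Proof. by move=> [_ _ IM] Ix _ [a _ <-]; exact: IM. Qed.

Lemma ideal_opp I x : is_ideal I -> I x -> I (- x).
Proof. by move=> [_ _ IM] Ix; rewrite -mulN1r; exact: IM. Qed.

Lemma ideal_addKr I a b : is_ideal I -> I b -> I (a + b) -> I a.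
Proof.
move=> idI Ib Iab; rewrite -(addrK b a).
by case: (idI) => _ ID _; apply: ID => //; exact: ideal_opp.
Qed.

Lemma nonprincipal_proper I : is_ideal I -> ~ is_principal I -> ~ I 1.
Proof.
move=> [_ _ IM] nI I1; apply: nI; exists 1; apply/seteqP; split=> x.
  by move=> _; exists x; rewrite ?mulr1.
by move=> [a _ <-]; exact: IM.
Qed.

Lemma nonprincipal_avoid I a : is_ideal I -> ~ is_principal I -> I a ->
  exists2 x, I x & ~ principal_ideal a x.
Proof.
move=> idI nI Ia; apply: contrapT => noX; apply: nI; exists a.
apply/seteqP; split; last exact: principal_sub.
by move=> x Ix; apply: contrapT => nax; apply: noX; exists x.
Qed.

(** This is the fact that a group is not the union of two proper subgroups. If
    [a] is in (b), anything avoiding (b) avoids (a) as well. Otherwise, for any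
    [y] in [I] avoiding (a), one of [y] and [a + y] avoids both. *)
Lemma nonprincipal_avoid2 I a b :
  is_ideal I -> ~ is_principal I -> I a -> I b ->
  exists x, [/\ I x, ~ principal_ideal a x & ~ principal_ideal b x].
Proof.
move=> idI nI Ia Ib.
have ida := principal_is_ideal a; have idb := principal_is_ideal b.
have [ba|nba] := pselect (principal_ideal b a).
  have [x Ix nbx] := nonprincipal_avoid idI nI Ib.
  by exists x; split=> // /(principal_sub idb ba).
have [y Iy nay] := nonprincipal_avoid idI nI Ia.
have [bY|nby] := pselect (principal_ideal b y); last by exists y.
exists (a + y); split.
- by case: idI => _ ID _; exact: ID.
- rewrite addrC => aya; apply: nay.
  exact: ideal_addKr ida (principal_id a) aya.
- by move=> bay; apply: nba; exact: ideal_addKr idb bY bay.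
Qed.

(** The hypothesis is asymmetric: for distinctness it is enough that each
    generator lies outside the ideals generated by the earlier ones. *)
Lemma uniq_principal (s : seq A) :
  pairwise (fun a b => ~~ `[< principal_ideal a b >]) s ->
  uniq [seq principal_ideal a | a <- s].
Proof.
rewrite uniq_pairwise pairwise_map; apply: sub_pairwise => a b /asboolP nab.
by apply/eqP => ab; apply: nab; rewrite ab; exact: principal_id.
Qed.

End Ideals.

Theorem proposition28 (A : comPzRingType) (hA : ideals A #<= `I_5) :
  principal_ring A.
Proof.
move=> I idI; apply: contrapT => nI.
have I0 : I 0%R by case: idI.
have nI1 := nonprincipal_proper idI nI.
have [x [Ix n0x _]] := nonprincipal_avoid2 idI nI I0 I0.
have [y [Iy n0y nxy]] := nonprincipal_avoid2 idI nI I0 Ix.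
have [z [Iz nxz nyz]] := nonprincipal_avoid2 idI nI Ix Iy.
have n0z : ~ principal_ideal 0%R z.
  have idx := principal_is_ideal x; have x0 : principal_ideal x 0%R by case: idx.
  by move/(principal_sub idx x0).
have n1 a : I a -> ~ principal_ideal a 1%R.
  by move=> Ia /(principal_sub idI Ia).
have u5 : uniq [seq principal_ideal a | a <- [:: 0%R; x; y; z; 1%R]].
  apply: uniq_principal; rewrite /= !andbT.
  by do !(apply/andP; split); apply/asboolP => //; exact: n1.
have u6 : uniq (I :: [seq principal_ideal a | a <- [:: 0%R; x; y; z; 1%R]]).
  rewrite cons_uniq u5 andbT; apply/negP => /mapP[a _ Ia].
  by apply: nI; exists a.
suff /(uniq_size_card_le hA u6) :
  forall J, J \in I :: [seq principal_ideal a | a <- [:: 0%R; x; y; z; 1%R]] ->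
    ideals A J by [].
move=> J; rewrite in_cons => /orP[/eqP-> //|/mapP[a _ ->]].
exact: principal_is_ideal.
Qed.
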